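(* Let $s\in(0,1)$. There exist constants $C>c>0$, only depending on $n$ and $s$, such that for any bounded, convex set $E\subset\mathbb{R}^n$ with nonempty interior the following inequalities hold: $$\underline{w_E}\ge c\left(\frac{|E|}{\mathrm{Per}_s(E)}\right)^{\frac1s},\qquad \underline{\rho_E}\ge c\left(\frac{|E|}{\mathrm{Per}_s(E)}\right)^{\frac1s},$$ $$\overline{w_E}\le C\,\big(\mathrm{Per}_s(E)\big)^{\frac{n-1}{s}}|E|^{\frac{1+s-n}{s}},\qquad \overline{\rho_E}\le C\,\big(\mathrm{Per}_s(E)\big)^{\frac{n-1}{s}}|E|^{\frac{1+s-n}{s}},$$ and $$\frac{\overline{\rho_E}}{\underline{\rho_E}}\le C\,\big(\mathrm{Per}_s(E)\big)^{\frac ns}|E|^{\frac{s-n}{s}}.$$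
   Context: $|E|$ is the Lebesgue measure of $E$. The fractional perimeter of $E$ is $$\mathrm{Per}_s(E)=s(1-s)\int_E\int_{E^c}\frac{dx\,dy}{|x-y|^{n+s}}.$$ For $\omega\in\partial B_1$ (the unit sphere of $\mathbb{R}^n$), the width of $E$ in direction $\omega$ is $w_E(\omega):=\sup_{x,y\in E}(x-y)\cdot\omega$, and $\underline{w_E}:=\inf_{\omega\in\partial B_1}w_E(\omega)$, $\overline{w_E}:=\sup_{\omega\in\partial B_1}w_E(\omega)$. The inner and outer radii are $$\underline{\rho_E}:=\sup\{r>0:\exists\,x_o\in\mathbb{R}^n,\ B_r(x_o)\subset E\},\qquad \overline{\rho_E}:=\inf\{r>0:\exists\,x_o\in\mathbb{R}^n,\ B_r(x_o)\supset E\}.$$ *)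

(* Defs.v *)
From HB Require Import structures.
From mathcomp Require Import all_boot all_order all_algebra.
From mathcomp Require Import all_classical all_reals all_analysis.

Set Implicit Arguments.
Unset Strict Implicit.
Unset Printing Implicit Defensive.

Import Order.TTheory GRing.Theory Num.Theory.
Import numFieldNormedType.Exports.

Local Open Scope classical_set_scope.
Local Open Scope ring_scope.

(* The library norm on ['rV[R]_n] is the sup norm. It is used below only for
   the topology and for boundedness, where the choice of norm is immaterial;
   lengths, balls and the unit sphere are Euclidean. *)
Section euclidean.
Context {R : realType} {n : nat}.
Implicit Types x y : 'rV[R]_n.

Definition dotv x y : R := \sum_(i < n) x ord0 i * y ord0 i.

Definition enorm x : R := Num.sqrt (dotv x x).

Definition eball x (r : R) : set 'rV[R]_n := [set y | enorm (y - x) < r].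

Definition esphere : set 'rV[R]_n := [set x | enorm x = 1].

End euclidean.

Section lebesgue.
Context (R : realType) (n : nat).

Definition box (a b : 'rV[R]_n) : set 'rV[R]_n :=
  [set x | forall i, a ord0 i <= x ord0 i <= b ord0 i].

Definition box_volume (a b : 'rV[R]_n) : R :=
  \prod_(i < n) Num.max 0 (b ord0 i - a ord0 i).

(* Covers are countable families of closed boxes, indexed by an arbitrary
   [K : set nat]; finite and empty families are allowed. *)
Definition lebesgue_outer (A : set 'rV[R]_n) : \bar R :=
  ereal_inf [set v | exists (K : set nat) (a b : nat -> 'rV[R]_n),
    A `<=` \bigcup_(k in K) box (a k) (b k) /\
    v = (\esum_(k in K) (box_volume (a k) (b k))%:E)%E].

Local Open Scope ereal_scope.

Let vol_ge0 a b : 0 <= (box_volume a b)%:E.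
Proof.
by rewrite lee_fin; apply: prodr_ge0 => i _; rewrite le_max lexx.
Qed.

Let outer_ge0 A : 0 <= lebesgue_outer A.
Proof.
by apply: le_ereal_inf_tmp => _ [K [a [b [_ ->]]]]; apply: esum_ge0 => *.
Qed.

Let outer0 : lebesgue_outer set0 = 0.
Proof.
apply/eqP; rewrite eq_le outer_ge0 andbT; apply: ereal_inf_lbound.
by exists set0, (fun=> 0%R), (fun=> 0%R); rewrite esum_set0; split.
Qed.

Let le_outer : {homo lebesgue_outer : A B / A `<=` B >-> A <= B}.
Proof.
move=> A B AB; apply/ereal_inf_le_tmp => _ [K [a [b [BK ->]]]].
by exists K, a, b; split => //; exact: subset_trans BK.
Qed.

Let outer_sigma_subadditive : sigma_subadditive lebesgue_outer.
Proof.
move=> A; have [[i ioo]|] := pselect (exists i, lebesgue_outer (A i) = +oo).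
  rewrite (eseries_pinfty _ _ ioo) ?leey// => k _.
  by rewrite -ltNye (lt_le_trans _ (outer_ge0 _)).
rewrite -forallNE => Aoo.
apply/lee_addgt0Pr => e e0.
rewrite (le_trans _ (epsilon_trick _ _ (ltW e0)))//.
pose P i (G : set nat * ((nat -> 'rV[R]_n) * (nat -> 'rV[R]_n))) :=
  A i `<=` \bigcup_(k in G.1) box (G.2.1 k) (G.2.2 k) /\
  \esum_(k in G.1) (box_volume (G.2.1 k) (G.2.2 k))%:E
    <= lebesgue_outer (A i) + (e / (2 ^ i.+1)%:R)%:E.
have [G PG] : {G & forall i, P i (G i)}.
  apply: (@choice _ _ P) => i.
  have fi : lebesgue_outer (A i) \is a fin_num.
    by rewrite ge0_fin_numE// ltey; exact/eqP/Aoo.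
  have en : (0 < e / (2 ^ i.+1)%:R)%R by rewrite divr_gt0// ltr0n expn_gt0.
  have [_ [K [a [b [AK ->]]]] lt] := lb_ereal_inf_adherent en fi.
  by exists (K, (a, b)); split => //; exact: ltW.
pose v (p : nat * nat) :=
  (box_volume ((G p.1).2.1 p.2) ((G p.1).2.2 p.2))%:E.
pose J := [set: nat] `*`` (fun i => (G i).1).
apply: (@le_trans _ _ (\esum_(p in J) v p)).
  apply: ereal_inf_lbound.
  have /card_esym/ppcard_eqP[f] := card_nat2.
  exists (f @^-1` J), (fun k => (G (f k).1).2.1 (f k).2),
    (fun k => (G (f k).1).2.2 (f k).2); split.
    move=> x [i _ /(PG i).1[j Gj xj]].
    by exists (f^-1%FUN (i, j)); rewrite /= invK ?inE.
  rewrite (@reindex_esum _ _ _ (f @^-1` J) J f)//; split => //.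
    by move=> x y _ _ /(congr1 (f^-1)%FUN); rewrite !funK ?inE.
  by move=> p Jp; exists (f^-1%FUN p); rewrite /= ?invK ?inE.
rewrite -(@esum_esum _ _ _ setT (fun i => (G i).1) (fun i j => v (i, j)));
  last by move=> *; exact: vol_ge0.
rewrite -nneseries_esumT/=; last by move=> i; apply: esum_ge0 => *; exact: vol_ge0.
apply: lee_nneseries => i *; last exact: (PG i).2.
by apply: esum_ge0 => *; exact: vol_ge0.
Qed.

HB.instance Definition _ := isOuterMeasure.Build R 'rV[R]_n lebesgue_outer
  outer0 outer_ge0 le_outer outer_sigma_subadditive.

(* The complete Lebesgue measure: [lebesgue_outer] on the sigma-algebra of its
   Caratheodory measurable sets. A convex set need not be Borel, so the
   completion matters here. *)
Definition lebesgue_rV : set (caratheodory_type lebesgue_outer) -> \bar R :=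
  lebesgue_outer.

HB.instance Definition _ := isMeasure.Build _ _ _ lebesgue_rV
  (caratheodory_measure0 _) (@caratheodory_measure_ge0 _ _ _)
  (@caratheodory_measure_sigma_additive _ _ _).

End lebesgue.

Arguments lebesgue_rV : clear implicits.

(* All quantities attached to [E] take values in the extended reals, so that no
   finiteness has to be presupposed. *)
Section quantities.
Context {R : realType} {n : nat}.
Implicit Types (E : set 'rV[R]_n) (w : 'rV[R]_n).
Local Open Scope ereal_scope.

Definition frac_perimeter (s : R) E : \bar R :=
  (s * (1 - s))%:E *
  \int[lebesgue_rV R n]_(x in E) \int[lebesgue_rV R n]_(y in ~` E)
    ((enorm (x - y) `^ (n%:R + s))^-1)%:E.

Definition width E w : \bar R :=
  ereal_sup [set (dotv (x - y) w)%:E | x in E & y in E].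

Definition min_width E : \bar R := ereal_inf [set width E w | w in esphere].

Definition max_width E : \bar R := ereal_sup [set width E w | w in esphere].

Definition inner_radius E : \bar R :=
  ereal_sup [set r%:E | r in [set r : R | (0 < r)%R /\
    exists x0, eball x0 r `<=` E]].

Definition outer_radius E : \bar R :=
  ereal_inf [set r%:E | r in [set r : R | (0 < r)%R /\
    exists x0, E `<=` eball x0 r]].

End quantities.

(* Main.v *)
(* The heart of the proof is Per_s(E) >= c |E| rho^(-s), with rho the inner
   radius. For every point x some cube {y | r <= sigma_i (y_i - x_i) <= 2 r},
   with signs sigma_i and r = 2 rho, misses E: otherwise E has points in all
   orthants around each point of the cube of half-side r centered at x, hence
   contains that cube by convexity, against the choice of r. So the inner
   integral at x is at least r^n (2 n r)^(-n-s). Moreover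
   |E| >= c rho^(n-1) diam E, because E contains the convex hull of a ball of
   radius rho / 2 and any of its points. Finally rho bounds the minimal width
   from below, and all the inequalities follow by eliminating rho. *)

Require Import Defs.
From HB Require Import structures.
From mathcomp Require Import all_boot all_order all_algebra.
From mathcomp Require Import all_classical all_reals all_analysis.
From mathcomp Require Import measurable_realfun.
From mathcomp Require Import ring lra.

Set Implicit Arguments.
Unset Strict Implicit.
Unset Printing Implicit Defensive.

Import Order.TTheory GRing.Theory Num.Theory.
Import numFieldNormedType.Exports.

Local Open Scope classical_set_scope.
Local Open Scope ring_scope.

(** * Lebesgue outer measure of boxes *)

Section box_measure.
Context {R : realType}.

(** Points are sequences of which only the first [n] entries count, so that induction on the
    dimension never changes the type of the point. *)
Definition seq_box_indic (n : nat) (a b x : nat -> R) : R :=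
  \prod_(i < n) \1_(`[a i, b i]%classic) (x i).

Definition seq_box_volume (n : nat) (a b : nat -> R) : R :=
  \prod_(i < n) Num.max 0 (b i - a i).

Lemma seq_box_indic_ge0 n a b x : 0 <= seq_box_indic n a b x.
Proof. by apply: prodr_ge0 => i _; rewrite indicE ler0n. Qed.

Lemma integral_itv_indic (r u v : R) : 0 <= r ->
  (\int[@lebesgue_measure R]_t (r * \1_(`[u, v]%classic) t)%:E =
    (r * Num.max 0 (v - u))%:E)%E.
Proof.
move=> r0; under eq_integral do rewrite EFinM.
rewrite ge0_integralZl_EFin//; last first.
  by apply/measurable_EFinP; exact: measurable_indic.
rewrite integral_indic// setIT [X in (_ * X)%E]lebesgue_measure_itv/= lte_fin.
case: ltP => uv; rewrite EFinM.
  by rewrite -EFinD max_r// subr_ge0 ltW.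
by rewrite max_l// subr_le0.
Qed.

(* Integrating out the last variable turns the pointwise inequality in
   dimension [n.+1] into one in dimension [n] with new weights. *)
Lemma seq_box_volume_le n (d : R) (a' b' : nat -> R)
    (c : nat -> R) (a b : nat -> nat -> R) :
  0 <= d -> (forall k, 0 <= c k) ->
  (forall x : nat -> R, (d * seq_box_indic n a' b' x)%:E <=
    \sum_(k <oo) (c k * seq_box_indic n (a k) (b k) x)%:E)%E ->
  ((d * seq_box_volume n a' b')%:E <=
    \sum_(k <oo) (c k * seq_box_volume n (a k) (b k))%:E)%E.
Proof.
elim: n d c => [|n IH] d c d0 c0 cov.
  have := cov (fun=> 0); rewrite /seq_box_volume /seq_box_indic !big_ord0.
  move=> /le_trans; apply; apply: lee_nneseries => k _.
    by move=> _; rewrite lee_fin big_ord0 mulr1.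
  by rewrite !big_ord0 lexx.
pose d' := d * Num.max 0 (b' n - a' n).
pose c' k := c k * Num.max 0 (b k n - a k n).
have -> : d * seq_box_volume n.+1 a' b' = d' * seq_box_volume n a' b'.
  by rewrite /seq_box_volume big_ord_recr/= /d' -mulrA (mulrC (Num.max _ _)).
have cE k : c k * seq_box_volume n.+1 (a k) (b k) =
    c' k * seq_box_volume n (a k) (b k).
  by rewrite /seq_box_volume big_ord_recr/= /c' -mulrA (mulrC (Num.max _ _)).
under eq_eseriesr do rewrite cE.
apply: IH => [|k|x].
- by rewrite mulr_ge0// le_max lexx.
- by rewrite mulr_ge0// le_max lexx.
pose y (t : R) i := if i == n then t else x i.
have yE t u v : seq_box_indic n.+1 u v (y t) =
    seq_box_indic n u v x * \1_(`[u n, v n]%classic) t.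
  rewrite /seq_box_indic big_ord_recr/= {2}/y eqxx; congr (_ * _).
  by apply: eq_bigr => i _; rewrite /y ltn_eqF.
have -> : ((d' * seq_box_indic n a' b' x)%:E =
    \int[@lebesgue_measure R]_t (d * seq_box_indic n.+1 a' b' (y t))%:E)%E.
  under eq_integral do rewrite yE mulrA.
  rewrite integral_itv_indic ?mulr_ge0 ?seq_box_indic_ge0//.
  by congr EFin; rewrite /d'; ring.
have mk r u v : measurable_fun setT
    (fun t => (r * seq_box_indic n.+1 u v (y t))%:E : \bar R).
  under eq_fun do rewrite yE mulrA.
  by apply/measurable_EFinP; exact: measurable_funM.
have ck0 k t : (0 <= (c k * seq_box_indic n.+1 (a k) (b k) (y t))%:E)%E.
  by rewrite lee_fin mulr_ge0 ?seq_box_indic_ge0.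
have -> : (\sum_(k <oo) (c' k * seq_box_indic n (a k) (b k) x)%:E =
    \int[@lebesgue_measure R]_t
      \sum_(k <oo) (c k * seq_box_indic n.+1 (a k) (b k) (y t))%:E)%E.
  rewrite integral_nneseries//; last by move=> k; exact: mk.
  apply: eq_eseriesr => k _.
  under eq_integral do rewrite yE mulrA.
  rewrite integral_itv_indic ?mulr_ge0 ?seq_box_indic_ge0//.
  by congr EFin; rewrite /c'; ring.
apply: ge0_le_integral => //.
- by move=> t _; rewrite lee_fin mulr_ge0 ?seq_box_indic_ge0.
- exact: mk.
- by apply: ge0_emeasurable_sum => // k _; exact: mk.
Qed.

Context {n : nat}.
Implicit Types (a b x : 'rV[R]_n) (X E : set 'rV[R]_n).

(* Row vectors, padded with zeros, as sequences. *)
Let pad x (i : nat) : R := oapp (x ord0) 0 (insub i).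

Let padE x (i : 'I_n) : pad x i = x ord0 i.
Proof. by rewrite /pad valK. Qed.

Let seq_box_volumeE a b : seq_box_volume n (pad a) (pad b) = box_volume a b.
Proof. by apply: eq_bigr => i _; rewrite !padE. Qed.

Let seq_box_indicE a b (x : nat -> R) :
  seq_box_indic n (pad a) (pad b) x = \1_(box a b) (\row_i x i).
Proof.
rewrite /seq_box_indic [RHS]indicE; case: (boolP (_ \in _)) => [/set_mem|] h.
  rewrite big1// => i _; rewrite indicE !padE mem_set//=.
  by have := h i; rewrite mxE in_itv.
have /existsNP[i hi] : ~ forall i : 'I_n, a ord0 i <= x i <= b ord0 i.
  by move=> h'; case/negP: h; apply/mem_set => i; rewrite mxE; exact: h'.
rewrite (bigD1 i)//= indicE memNset ?mul0r//=.
by rewrite in_itv/= !padE.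
Qed.

Lemma box_volume_ge0 a b : 0 <= box_volume a b.
Proof. by apply: prodr_ge0 => i _; rewrite le_max lexx. Qed.

(** A cover of [box a b] gives a pointwise bound of its indicator by the sum of the indicators of
    the covering boxes. Integrating this bound one variable at a time compares the volumes; the
    weights [c k], equal to 0 or 1, select the indices in [K]. *)
Lemma lebesgue_outer_ge_box X a b :
  box a b `<=` X -> ((box_volume a b)%:E <= lebesgue_outer X)%E.
Proof.
move=> abX; apply: le_ereal_inf_tmp => _ [K [u [v [XK ->]]]].
pose c k : R := (k \in K)%:R.
have := @seq_box_volume_le n 1 (pad a) (pad b) c (pad \o u) (pad \o v).
rewrite mul1r seq_box_volumeE => /(_ ler01) H.
rewrite esum_mkcond -nneseries_esumT; last first.
  by move=> k; case: ifP => // _; rewrite lee_fin box_volume_ge0.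
have -> : (\sum_(k <oo) (if k \in K then (box_volume (u k) (v k))%:E else 0) =
    \sum_(k <oo) (c k * seq_box_volume n ((pad \o u) k) ((pad \o v) k))%:E)%E.
  apply: eq_eseriesr => k _; rewrite /= seq_box_volumeE /c.
  by case: ifP; rewrite ?mul1r ?mul0r.
apply: H => [k|x]; first by rewrite ler0n.
have t0 k : (0 <= (c k * seq_box_indic n ((pad \o u) k) ((pad \o v) k) x)%:E)%E.
  by rewrite lee_fin mulr_ge0 ?ler0n ?seq_box_indic_ge0.
rewrite mul1r seq_box_indicE indicE; case: (boolP (_ \in _)) => [/set_mem|_];
  last by apply: nneseries_ge0 => *; exact: t0.
move=> /abX /XK[k Kk xk].
rewrite (@nneseriesD1 _ _ k)//= seq_box_indicE indicE mem_set//.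
rewrite /c mem_set// mulr1.
by rewrite leeDl//; apply: nneseries_ge0 => *; exact: t0.
Qed.

Lemma lebesgue_outer_box a b : lebesgue_outer (box a b) = (box_volume a b)%:E.
Proof.
apply/eqP; rewrite eq_le lebesgue_outer_ge_box// andbT.
apply: ereal_inf_lbound; exists [set 0%N], (fun=> a), (fun=> b); split.
  by rewrite bigcup_set1.
by rewrite esum_set1// lee_fin box_volume_ge0.
Qed.

End box_measure.

(** * Caratheodory measurability of boxes, and measurable sets inside [E] *)

Section lebesgue_measurability.
Context {R : realType} {n : nat}.
Implicit Types (a b x : 'rV[R]_n) (E : set 'rV[R]_n).

Local Notation cara := (caratheodory_type (@lebesgue_outer R n)).

(** Additivity of length when the interval from [u] to [v], possibly empty, is cut at [t]. *)
Lemma max0_sub_split (u v t : R) :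
  Num.max 0 (Num.min v t - u) + Num.max 0 (v - Num.max u t) = Num.max 0 (v - u).
Proof.
rewrite !maxEle !minEle; case: (leP v t) => vt; case: (leP u t) => ut;
  rewrite ?subr_ge0; by do ?case: leP => ?; lra.
Qed.

(* The hyperplane itself may be split arbitrarily between [A] and its
   complement, so that both closed and open half-spaces are covered. *)
Lemma measurable_halfspace (j : 'I_n) (t : R) (A : set cara) :
  A `<=` [set x : 'rV[R]_n | x ord0 j <= t] ->
  ~` A `<=` [set x : 'rV[R]_n | t <= x ord0 j] -> measurable A.
Proof.
move=> At tA; apply: le_caratheodory_measurable => X.
apply: le_ereal_inf_tmp => _ [K [a [b [XK ->]]]].
(* Each covering box is cut along the hyperplane: [box (a k) (b' k)] is the lower piece and
   [box (a' k) (b k)] the upper one, and their volumes add up. *)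
pose b' k : 'rV[R]_n :=
  \row_i if i == j then Num.min (b k ord0 j) t else b k ord0 i.
pose a' k : 'rV[R]_n :=
  \row_i if i == j then Num.max (a k ord0 j) t else a k ord0 i.
have volE k : box_volume (a k) (b k) =
    box_volume (a k) (b' k) + box_volume (a' k) (b k).
  rewrite /box_volume !(bigD1 j (P := xpredT))//=.
  rewrite !mxE !eqxx -(max0_sub_split _ _ t) mulrDl.
  by congr (_ * _ + _ * _); apply: eq_bigr => i ij; rewrite mxE (negbTE ij).
under [leRHS]eq_esum do rewrite volE EFinD.
rewrite esumD; last 2 first.
- by move=> k _; rewrite lee_fin box_volume_ge0.
- by move=> k _; rewrite lee_fin box_volume_ge0.
apply: leeD; apply: ereal_inf_lbound.
- exists K, a, b'; split => // x [/XK[k Kk xk] /At/= xt].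
  exists k => // i; rewrite mxE; have /andP[-> xi] := xk i.
  by case: eqP xi => // -> xi; rewrite le_min xi.
- exists K, a', b; split => // x [/XK[k Kk xk] /tA/= xt].
  exists k => // i; rewrite mxE; have /andP[xi ->] := xk i; rewrite andbT.
  by case: eqP xi => // -> xi; rewrite ge_max xi.
Qed.

Lemma measurable_box a b : measurable (box a b : set cara).
Proof.
have -> : box a b = \bigcap_(i in [set: 'I_n])
    ([set x : cara | (x : 'rV[R]_n) ord0 i <= b ord0 i] `&`
     ~` [set x : cara | (x : 'rV[R]_n) ord0 i < a ord0 i]).
  apply/seteqP; split => [x xab i _|x h i].
    by have /andP[? ?] := xab i; split => //=; apply/negP; rewrite -leNgt.
  have [//|/= -> /negP] := h i.
  by rewrite -leNgt => ->.
apply: fin_bigcap_measurable => // i _; apply: measurableI.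
  apply: (@measurable_halfspace i (b ord0 i)) => // x /= /negP.
  by rewrite -ltNge => /ltW.
apply: measurableC; apply: (@measurable_halfspace i (a ord0 i)) => x /=.
  exact: ltW.
by move/negP; rewrite -leNgt.
Qed.

(* A convex set [E] need not be Borel; this union of rational boxes is
   measurable and contains the interior of [E]. *)
Definition box_interior E : set 'rV[R]_n :=
  \bigcup_(p in [set p : 'rV[rat]_n * nat |
      box (\row_i (ratr (p.1 ord0 i) - p.2.+1%:R^-1))
          (\row_i (ratr (p.1 ord0 i) + p.2.+1%:R^-1)) `<=` E])
    box (\row_i (ratr (p.1 ord0 i) - p.2.+1%:R^-1))
        (\row_i (ratr (p.1 ord0 i) + p.2.+1%:R^-1)).

Lemma measurable_box_interior E : measurable (box_interior E : set cara).
Proof.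
rewrite /box_interior bigcup_mkcond; apply: countable_bigcupT_measurable.
  exact: countableP.
by move=> p; case: ifP => _; [exact: measurable_box|exact: measurable0].
Qed.

Lemma box_interior_sub E : box_interior E `<=` E.
Proof. by move=> x [p]; exact. Qed.

(** A rational center within [m.+1%:R^-1 <= e / 2] of [x] in each coordinate carries a box of that
    half-side, which contains [x] and stays within [e] of it. *)
Lemma mem_box_interior E x (e : R) : 0 < e ->
  (forall y : 'rV[R]_n, (forall i, `|y ord0 i - x ord0 i| <= e) -> E y) ->
  box_interior E x.
Proof.
move=> e0 xE.
pose m := Num.truncn (2 / e).
have m0 : 0 < m.+1%:R^-1 :> R by rewrite invr_gt0 ltr0n.
have me : m.+1%:R^-1 <= e / 2 :> R.
  rewrite -[leRHS]invrK invf_div lef_pV2 ?posrE ?ltr0n ?divr_gt0//.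
  by rewrite ltW// truncnS_gt.
have /choice[q qP] : forall i, exists q : rat,
    x ord0 i - m.+1%:R^-1 < ratr q < x ord0 i + m.+1%:R^-1.
  move=> i; have [|q] := @rat_in_itvoo R (x ord0 i - m.+1%:R^-1)
    (x ord0 i + m.+1%:R^-1).
    by rewrite ltrBlDr -addrA ltrDl addr_gt0.
  by rewrite in_itv/= => qP; exists q.
exists (\row_i q i, m) => /= [y h|i].
  apply: xE => i; have := h i; have := qP i; rewrite !mxE ler_norml.
  move: m0 me; move: (m.+1%:R^-1) => d d0 de /andP[? ?] /andP[? ?].
  by apply/andP; split; lra.
have := qP i; rewrite !mxE; move: (m.+1%:R^-1) => d /andP[? ?].
by apply/andP; split; lra.
Qed.

(** A cover of [E'] pulls back to a cover of [E] by boxes with doubled sides. Only covers are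
    involved, so this applies to nonmeasurable [E]. *)
Lemma lebesgue_outer_homothety E E' x :
  (forall y, E y -> E' (2^-1 *: (x + y))) ->
  (lebesgue_outer E <= (2 ^+ n)%:E * lebesgue_outer E')%E.
Proof.
move=> EE'; rewrite -lee_pdivrMl ?exprn_gt0//.
apply: le_ereal_inf_tmp => _ [K [a [b [E'K ->]]]].
rewrite lee_pdivrMl ?exprn_gt0//.
apply: ereal_inf_lbound.
exists K, (fun k => 2 *: a k - x), (fun k => 2 *: b k - x); split.
  move=> y /EE'/E'K[k Kk yk]; exists k => // i.
  by have := yk i; rewrite !mxE => /andP[? ?]; apply/andP; split; lra.
rewrite [in LHS]esum_mkcond [in RHS]esum_mkcond -!nneseries_esumT; last 2 first.
- by move=> k; case: ifP => _ //; rewrite lee_fin box_volume_ge0.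
- by move=> k; case: ifP => _ //; rewrite lee_fin box_volume_ge0.
rewrite -nneseriesZl//; last first.
  by move=> k _; case: ifP => _ //; rewrite lee_fin box_volume_ge0.
apply: eq_eseriesr => k _; case: ifP => _; last by rewrite mule0.
have -> : (2 : R) ^+ n = \prod_(i < n) 2 by rewrite prodr_const card_ord.
rewrite -EFinM /box_volume -big_split; congr EFin.
apply: eq_bigr => i _; rewrite !mxE /= maxr_pMr// mulr0; congr Num.max; lra.
Qed.

End lebesgue_measurability.

(* Neither [f] nor [D] need be measurable, since the integral of a nonnegative
   function is a supremum over simple functions below it. *)
Lemma ge0_integral_ge_cst d (T : measurableType d) (R : realType)
    (mu : {measure set T -> \bar R}) (D A : set T) (f : T -> \bar R) (c : R) :
  0 <= c -> measurable A -> A `<=` D ->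
  (forall x, D x -> 0 <= f x)%E -> (forall x, A x -> c%:E <= f x)%E ->
  (c%:E * mu A <= \int[mu]_(x in D) f x)%E.
Proof.
move=> c0 mA AD f0 cf; rewrite ge0_integralE//.
apply: ereal_sup_ubound; exists (scale_nnsfun (indic_nnsfun R mA) c0) => /=.
  move=> x; rewrite patchE /mindic/= indicE; case: (boolP (x \in A)) => xA.
    by rewrite mulr1 mem_set; [apply/cf/set_mem|apply/AD/set_mem].
  by rewrite mulr0; case: ifP => // /set_mem; exact: f0.
by rewrite sintegralrM sintegral_indic.
Qed.

(** * Convex sets, orthants and the potential of the complement *)

Section convexity.
Context {R : realType} {n : nat}.
Implicit Types (x y z : 'rV[R]_n) (E : set 'rV[R]_n).

Lemma convex_setE E : convex_set E -> forall x y (t : R),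
  0 <= t <= 1 -> E x -> E y -> E (t *: x + (1 - t) *: y).
Proof.
move=> cE x y t /andP[t0 t1] Ex Ey.
have := cE x y (Itv01 t0 t1).
by rewrite !inE; apply.
Qed.
End convexity.

Section convex_geometry.
Context {R : realType} {n : nat}.
Implicit Types (x y z v : 'rV[R]_n) (E : set 'rV[R]_n).

Lemma convex_mem_orthants E z : convex_set E ->
  (forall sg : 'I_n -> bool, exists2 p : 'rV[R]_n, E p &
    forall i, 0 <= (-1) ^+ sg i * (p ord0 i - z ord0 i)) ->
  E z.
Proof.
move=> cE orth.
(* Coordinates are matched one at a time, on segments joining points of
   opposite orthants. *)
suff /(_ n (leqnn n) (fun=> false))[p [Ep pz _]] :
    forall k, (k <= n)%N -> forall sg : 'I_n -> bool, exists p : 'rV[R]_n,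
    [/\ E p, forall i : 'I_n, (i < k)%N -> p ord0 i = z ord0 i &
      forall i : 'I_n, (k <= i)%N ->
        0 <= (-1) ^+ sg i * (p ord0 i - z ord0 i)].
  by rewrite (_ : z = p)//; apply/rowP => i; rewrite pz.
elim=> [_ sg|k IH kn sg]; first by have [p Ep pz] := orth sg; exists p.
pose j := Ordinal kn.
pose sgj b i := if i == j then b else sg i.
have [p [Ep pE pz]] := IH (ltnW kn) (sgj false).
have [q [Eq qE qz]] := IH (ltnW kn) (sgj true).
have /= := pz j (leqnn _); rewrite /sgj eqxx expr0 mul1r.
have /= := qz j (leqnn _); rewrite /sgj eqxx expr1 mulN1r opprB.
set v := _ - q _ _; set u := p _ _ - _ => v0 u0.
(* Both offsets are nonnegative, so a zero sum means that [p] already agrees with [z] in coordinate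
   [j]. *)
have [/eqP uv0|uv0] := eqVneq (u + v) 0.
  exists p; split=> // i; last first.
    by move=> ki; have := pz i (ltnW ki); rewrite /sgj -val_eqE/= gtn_eqF.
  rewrite ltnS leq_eqVlt => /predU1P[ik|]; last exact: pE.
  have -> : i = j by exact: val_inj.
  by apply/eqP; rewrite -subr_eq0; move: uv0; rewrite paddr_eq0// => /andP[].
have uvp : 0 < u + v by rewrite lt0r uv0 addr_ge0.
(* The weight at which the offsets [u] of [p] and [- v] of [q] in coordinate [j] cancel. The later
   coordinates of [p] and [q] lie on the same side of [z], so the combination keeps their signs. *)
pose t := v / (u + v).
have t01 : 0 <= t <= 1.
  by rewrite divr_ge0 ?(ltW uvp)//= ler_pdivrMr// mul1r lerDr.
have [t0 t1] := andP t01.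
exists (t *: p + (1 - t) *: q); split=> [|i|i ki].
- exact: convex_setE.
- rewrite ltnS leq_eqVlt !mxE => /predU1P[ik|ik]; last first.
    by rewrite pE// qE// -mulrDl addrC subrK mul1r.
  have -> : i = j by exact: val_inj.
  have pj : p ord0 j = z ord0 j + u by rewrite /u addrC subrK.
  have qj : q ord0 j = z ord0 j - v by rewrite /v opprB addrC subrK.
  by rewrite pj qj /t; field.
- have := pz i (ltnW ki); have := qz i (ltnW ki).
  rewrite /sgj -val_eqE/= gtn_eqF// !mxE => qi pi.
  have -> : (-1) ^+ sg i * (t * p ord0 i + (1 - t) * q ord0 i - z ord0 i) =
      t * ((-1) ^+ sg i * (p ord0 i - z ord0 i)) +
      (1 - t) * ((-1) ^+ sg i * (q ord0 i - z ord0 i)) by ring.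
  by apply: addr_ge0; apply: mulr_ge0; rewrite ?subr_ge0.
Qed.

Definition cube x (r : R) : set 'rV[R]_n :=
  box (x - const_mx r) (x + const_mx r).

Lemma cubeP x r y : cube x r y <-> forall i, `|y ord0 i - x ord0 i| <= r.
Proof.
split=> h i; have := h i; rewrite !mxE ler_norml => /andP[? ?];
  by apply/andP; split; lra.
Qed.

(** The cube [r <= (-1) ^+ sg i * (y_i - x_i) <= 2 * r]: the value [true] of [sg i] stands for the
    negative sign. *)
Definition corner_box x (r : R) (sg : 'I_n -> bool) : set 'rV[R]_n :=
  box (\row_i (x ord0 i + if sg i then - (2 * r) else r))
      (\row_i (x ord0 i + if sg i then - r else 2 * r)).

(** Seen from any [z] in [cube x r], the points of [corner_box x r sg] lie in the orthant [sg],
    because [z] is off [x] by at most [r] in each coordinate. If all corner boxes met [E], every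
    such [z] would be in [E]. *)
Lemma corner_box_disjoint E x (r : R) : convex_set E -> ~ (cube x r `<=` E) ->
  exists sg, corner_box x r sg `<=` ~` E.
Proof.
move=> cE; apply: contra_notP => /forallNP h z /cubeP zx.
apply: convex_mem_orthants => // sg.
have /existsNP[p /not_implyP[pQ /contrapT Ep]] := h sg.
exists p => // i; have := pQ i; have := zx i; rewrite !mxE ler_norml.
by case: (sg i); rewrite ?expr0 ?expr1 => /andP[? ?] /andP[? ?]; lra.
Qed.

Lemma corner_box_volume x (r : R) sg : 0 <= r ->
  lebesgue_outer (corner_box x r sg) = (r ^+ n)%:E.
Proof.
move=> r0; rewrite lebesgue_outer_box /box_volume; congr EFin.
rewrite -[in RHS](card_ord n) -prodr_const; apply: eq_bigr => i _.
by rewrite !mxE; case: (sg i); rewrite max_r; lra.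
Qed.

Lemma ler_norm_enorm v i : `|v ord0 i| <= enorm v.
Proof.
rewrite -sqrtr_sqr ler_sqrt ?sumr_ge0// => [|k _]; last exact: sqr_ge0.
rewrite /dotv (bigD1 i)//= -expr2 lerDl sumr_ge0// => k _; exact: sqr_ge0.
Qed.

Lemma enorm_le_sum v : enorm v <= \sum_i `|v ord0 i|.
Proof.
have s0 : 0 <= \sum_i `|v ord0 i| by exact: sumr_ge0.
rewrite -[leRHS]ger0_norm// -sqrtr_sqr ler_sqrt ?sqr_ge0//.
rewrite expr2 mulr_suml; apply: ler_sum => i _.
rewrite -expr2 -real_normK ?num_real// expr2 ler_wpM2l//.
by rewrite (bigD1 i)//= lerDl sumr_ge0.
Qed.

Lemma enorm_le_bound v (r : R) :
  (forall i, `|v ord0 i| <= r) -> enorm v <= n%:R * r.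
Proof.
move=> vr; apply: le_trans (enorm_le_sum v) _.
by rewrite -[n in leRHS]card_ord mulr_natl -sumr_const; exact: ler_sum.
Qed.

(** On the corner box that misses [E], the distance to [x] is at most [n * (2 * r)], which bounds
    the kernel from below; the volume of that box is [r ^+ n]. *)
Lemma complement_potential_ge E x (r s : R) : (0 < n)%N -> 0 < r -> 0 < s ->
  convex_set E -> ~ (cube x r `<=` E) ->
  ((((n%:R * (2 * r)) `^ (n%:R + s))^-1 * r ^+ n)%:E <=
    \int[lebesgue_rV R n]_(y in ~` E) ((enorm (x - y) `^ (n%:R + s))^-1)%:E)%E.
Proof.
move=> n0 r0 s0 cE /corner_box_disjoint -/(_ cE)[sg sgE].
rewrite EFinM -(corner_box_volume x sg (ltW r0)).
apply: (@ge0_integral_ge_cst _ _ _ (lebesgue_rV R n)) => //.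
- by rewrite invr_ge0 powR_ge0.
- exact: measurable_box.
- by move=> y _; rewrite lee_fin invr_ge0 powR_ge0.
move=> y xy; rewrite lee_fin.
have yx i : r <= `|(x - y) ord0 i| <= 2 * r.
  have := xy i; rewrite !mxE; case: (sg i) => /andP[? ?].
    by rewrite ger0_norm; last lra; apply/andP; split; lra.
  by rewrite ler0_norm; last lra; apply/andP; split; lra.
(* Since [0 < n], some coordinate exists, and its modulus is at least [r]. The distance is thus
   positive, and inversion reverses the order. *)
have e0 : 0 < enorm (x - y).
  apply: lt_le_trans r0 _; have /andP[h _] := yx (Ordinal n0).
  exact: le_trans h (ler_norm_enorm _ _).
have ns0 : 0 < n%:R + s by rewrite ltr_wpDl.
rewrite lef_pV2 ?posrE ?powR_gt0 ?mulr_gt0 ?ltr0n//.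
apply: ge0_ler_powR; rewrite ?nnegrE ?(ltW ns0) ?(ltW e0)//.
  by rewrite !mulr_ge0// ltW.
by apply: enorm_le_bound => i; have /andP[] := yx i.
Qed.

End convex_geometry.

(** * Lower bounds for perimeter and volume; cubes against balls *)

Section volume_perimeter.
Context {R : realType} {n : nat}.
Implicit Types (x y z v : 'rV[R]_n) (E : set 'rV[R]_n).

(** A point [w] near the midpoint of [x] and [y] is itself the midpoint of [y] and of [2 *: w - y],
    which lies in [cube x e]. So a half-size copy of [E] lies in the measurable set
    [box_interior E]. *)
Lemma convex_sub_box_interior E x (e : R) y : convex_set E -> 0 < e ->
  cube x e `<=` E -> E y -> box_interior E (2^-1 *: (x + y)).
Proof.
move=> cE e0 xE Ey; apply: (@mem_box_interior _ _ _ _ (e / 2)) => [|w wy].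
  by rewrite divr_gt0.
have -> : w = 2^-1 *: (2 *: w - y) + (1 - 2^-1) *: y.
  by apply/rowP => i; rewrite !mxE; lra.
apply: convex_setE => //; first by apply/andP; split; lra.
apply/xE/cubeP => i; have := wy i; rewrite !mxE !ler_norml.
by move=> /andP[? ?]; apply/andP; split; lra.
Qed.

(** [K] bounds the inner integral from below at every point. The outer integral is restricted to
    [box_interior E], whose measure is at least that of [E] divided by [2 ^+ n]. *)
Lemma frac_perimeter_ge E x (e r s : R) : (0 < n)%N -> 0 < r ->
  0 < s -> s < 1 -> convex_set E -> 0 < e -> cube x e `<=` E ->
  (forall y, ~ cube y r `<=` E) ->
  ((s * (1 - s) * ((n%:R * (2 * r)) `^ (n%:R + s))^-1 * r ^+ n / 2 ^+ n)%:E *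
    lebesgue_rV R n E <= frac_perimeter s E)%E.
Proof.
move=> n0 r0 s0 s1 cE e0 xE rE.
set K := ((n%:R * (2 * r)) `^ (n%:R + s))^-1 * r ^+ n.
have K0 : 0 <= K.
  by apply: mulr_ge0; rewrite ?invr_ge0 ?powR_ge0// exprn_ge0// ltW.
have ss0 : 0 <= s * (1 - s) by apply: mulr_ge0; rewrite ?subr_ge0 ltW.
have potE y : (K%:E <= \int[lebesgue_rV R n]_(z in ~` E)
    ((enorm (y - z) `^ (n%:R + s))^-1)%:E)%E.
  exact: complement_potential_ge.
have intE : (K%:E * lebesgue_rV R n (box_interior E) <=
    \int[lebesgue_rV R n]_(y in E) \int[lebesgue_rV R n]_(z in ~` E)
    ((enorm (y - z) `^ (n%:R + s))^-1)%:E)%E.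
  apply: (@ge0_integral_ge_cst _ _ _ (lebesgue_rV R n)) => //.
  - exact: measurable_box_interior.
  - exact: box_interior_sub.
  - by move=> y _; apply: le_trans (potE y); rewrite lee_fin.
rewrite /frac_perimeter.
have -> : s * (1 - s) * ((n%:R * (2 * r)) `^ (n%:R + s))^-1 * r ^+ n / 2 ^+ n =
    (s * (1 - s)) * (K / 2 ^+ n) by rewrite /K; ring.
rewrite EFinM -muleA lee_wpmul2l ?lee_fin//; apply: le_trans intE.
rewrite EFinM -muleA lee_wpmul2l ?lee_fin// lee_pdivrMl ?exprn_gt0//.
apply: lebesgue_outer_homothety => y Ey.
exact: convex_sub_box_interior xE Ey.
Qed.

Lemma cube_volume x (r : R) : 0 <= r ->
  lebesgue_outer (cube x r) = ((2 * r) ^+ n)%:E.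
Proof.
move=> r0; rewrite lebesgue_outer_box /box_volume; congr EFin.
rewrite -[in RHS](card_ord n) -prodr_const; apply: eq_bigr => i _.
by rewrite !mxE max_r; lra.
Qed.

(* Shrunken copies of the cube, centered on the half of the segment from [x]
   to [p] that is closer to [x], are disjoint and contained in [E]. *)
Lemma convex_volume_ge E x p (h : R) j : convex_set E -> 0 < h ->
  cube x h `<=` E -> E p ->
  ((`|p ord0 j - x ord0 j| * h ^+ n)%:E <=
    (2 ^+ n.+1 * h)%:E * lebesgue_rV R n E)%E.
Proof.
move=> cE h0 xE Ep; set L := `|_ - _|.
have [->|L0] := eqVneq L 0.
  by rewrite mul0r mule_ge0// lee_fin mulr_ge0 ?exprn_ge0 ?(ltW h0).
have {}L0 : 0 < L by rewrite lt0r L0 normr_ge0.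
(* [N * h <= L / 2] keeps all centers on the half of the segment nearer to [x], while
   [N.+1 * (2 * h) >= L] makes the total volume proportional to [L]. *)
pose N := Num.truncn (L / (2 * h)).
have LN : L <= 2 * h * N.+1%:R.
  by rewrite mulrC -ler_pdivrMr ?mulr_gt0// ltW// truncnS_gt.
have NL : N%:R * (2 * h) <= L.
  by rewrite -ler_pdivlMr ?mulr_gt0// truncn_le// divr_ge0// ?ltW// mulr_gt0.
(* Consecutive centers differ by [h] in coordinate [j], so cubes of half-side [h / 4] are disjoint.
   With [t = k * h / L <= 1 / 2], the homothety of center [p] and ratio [1 - t] sends [cube x h] to
   a cube about [c k] of half-side at least [h / 2], contained in [E]. *)
pose c (k : nat) : 'rV[R]_n := x + (k%:R * h / L) *: (p - x).
pose F (k : 'I_N.+1) : set (caratheodory_type (@lebesgue_outer R n)) :=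
  cube (c k) (h / 4).
have FE k : F k `<=` E.
  move=> y /cubeP yk.
  pose t := k%:R * h / L.
  have t0 : 0 <= t by rewrite !mulr_ge0 ?invr_ge0 ?ler0n// ltW.
  have t2 : t <= 1 / 2.
    rewrite ler_pdivrMr//.
    have : (k%:R : R) * h <= N%:R * h.
      by rewrite ler_wpM2r ?(ltW h0)// ler_nat -ltnS.
    by move: NL; lra.
  have t1 : 0 < 1 - t by lra.
  have -> : y = t *: p + (1 - t) *: ((1 - t)^-1 *: (y - t *: p)).
    by rewrite scalerA divff ?gt_eqF// scale1r addrC subrK.
  apply: convex_setE => //; first by apply/andP; split; lra.
  apply/xE/cubeP => i; have := yk i; rewrite /c -/t !mxE => yki.
  have -> : (1 - t)^-1 * (y ord0 i - t * p ord0 i) - x ord0 i =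
      (1 - t)^-1 * (y ord0 i - (x ord0 i + t * (p ord0 i - x ord0 i))).
    by field; rewrite gt_eqF.
  rewrite normrM gtr0_norm ?invr_gt0// ler_pdivrMl//.
  apply: le_trans yki _; apply: (@le_trans _ _ (1 / 2 * h)); first by lra.
  by rewrite ler_wpM2r ?(ltW h0)//; lra.
have Fdisj : trivIset setT F.
  have lt_disj (k l : nat) y : (k < l)%N -> cube (c k) (h / 4) y ->
      cube (c l) (h / 4) y -> False.
    move=> kl /cubeP/(_ j) yk /cubeP/(_ j) yl.
    have lk : 1 <= l%:R - k%:R :> R by rewrite lerBrDr nat1r ler_nat.
    have : `|c l ord0 j - c k ord0 j| = (l%:R - k%:R) * h.
      rewrite !mxE; set d := p ord0 j - x ord0 j.
      have -> : x ord0 j + l%:R * h / L * d - (x ord0 j + k%:R * h / L * d) =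
        (l%:R - k%:R) * h / L * d by ring.
      rewrite !normrM -/L (gtr0_norm (_ : 0 < L^-1)) ?invr_gt0//.
      rewrite divfK ?gt_eqF//.
      by rewrite (gtr0_norm h0) ger0_norm//; lra.
    have : `|c l ord0 j - c k ord0 j| <= h / 4 + h / 4.
      have -> : c l ord0 j - c k ord0 j =
        (y ord0 j - c k ord0 j) - (y ord0 j - c l ord0 j) by ring.
      by apply: le_trans (ler_normB _ _) _; exact: lerD.
    have : h <= (l%:R - k%:R) * h by rewrite ler_peMl ?(ltW h0).
    by lra.
  move=> k l _ _ [y [yk yl]]; apply/val_inj.
  have [kl|lk|//] := ltngtP (val k) (val l); exfalso.
    exact: lt_disj kl yk yl.
  exact: lt_disj lk yl yk.
have : (lebesgue_rV R n (\big[setU/set0]_(k < N.+1) F k) <=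
    lebesgue_rV R n E)%E.
  apply: le_outer_measure; rewrite -bigcup_mkord_ord.
  by move=> y [k _]; exact: FE.
rewrite (@measure_bigsetU_ord _ _ _ (lebesgue_rV R n))//; last first.
  by move=> k; exact: measurable_box.
have -> : (\sum_(k < N.+1) lebesgue_rV R n (F k) =
    (N.+1%:R * (h / 2) ^+ n)%:E)%E.
  under eq_bigr do rewrite /lebesgue_rV cube_volume ?divr_ge0 ?(ltW h0)//.
  rewrite sumEFin sumr_const card_ord -[_ *+ N.+1]mulr_natl.
  by congr EFin; congr (_ * _ ^+ _); field.
have a0 : (0 <= (2 ^+ n.+1 * h)%:E)%E.
  by rewrite lee_fin mulr_ge0 ?exprn_ge0 ?(ltW h0).
move=> /(lee_wpmul2l a0); apply: le_trans.
rewrite -EFinM lee_fin.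
have -> : 2 ^+ n.+1 * h * (N.+1%:R * (h / 2) ^+ n) =
    (2 * h * N.+1%:R) * h ^+ n.
  by rewrite expr_div_n exprS; field; rewrite expf_neq0.
by rewrite ler_wpM2r ?exprn_ge0 ?(ltW h0).
Qed.

Lemma eball_sub_cube x (r : R) : eball x r `<=` cube x r.
Proof.
move=> y yr; apply/cubeP => i; apply: le_trans (ltW yr).
by have := ler_norm_enorm (y - x) i; rewrite !mxE.
Qed.

(** Dividing by [n.+1] rather than [n] yields the strict inequality required by the open ball. *)
Lemma cube_sub_eball x (r : R) : 0 < r -> cube x (r / n.+1%:R) `<=` eball x r.
Proof.
move=> r0 y /cubeP yr; apply: (@le_lt_trans _ _ (n%:R * (r / n.+1%:R))).
  by apply: enorm_le_bound => i; rewrite !mxE.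
by rewrite mulrCA gtr_pMr// ltr_pdivrMr ?ltr0n// mul1r ltr_nat.
Qed.

Lemma bounded_set_sub_cube E : bounded_set E ->
  exists2 M : R, 0 < M & E `<=` cube 0 M.
Proof.
(* The bound holds for every number strictly above [M]; the maximum with 1 makes it positive. *)
move=> [M [_ ME]]; exists (Num.max 1 (M + 1)); first by rewrite lt_max ltr01.
move=> y Ey; apply/cubeP => i; rewrite mxE subr0.
apply: (@le_trans _ _ `|y|); last first.
  by apply: ME => //; rewrite lt_max ltrDl ltr01 orbT.
rewrite [leRHS]/Num.norm/= mx_normrE.
exact: (le_bigmax _ (fun ij : 'I_1 * 'I_n => `|y ij.1 ij.2|) (ord0, i)).
Qed.

Lemma interior_cube E x : E° x -> exists2 e : R, 0 < e & cube x e `<=` E.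
Proof.
move=> /nbhs_ballP[e /= e0 xE]; exists (e / 2); first by rewrite divr_gt0.
move=> y /cubeP yx; apply: xE; split=> // i k; rewrite !ord1 /ball/=.
by rewrite distrC; apply: le_lt_trans (yx k) _; lra.
Qed.

Lemma lebesgue_outer_cubes E x (e M : R) : 0 < e -> cube x e `<=` E ->
  E `<=` cube 0 M -> exists2 v : R, 0 < v & lebesgue_outer E = v%:E.
Proof.
move=> e0 xE EM.
have eE : (((2 * e) ^+ n)%:E <= lebesgue_outer E)%E.
  by rewrite -(cube_volume x (ltW e0)); exact: le_outer_measure.
have E0 : (0 < lebesgue_outer E)%E.
  by apply: lt_le_trans eE; rewrite lte_fin exprn_gt0// mulr_gt0.
exists (fine (lebesgue_outer E)); last first.
  rewrite fineK// ge0_fin_numE ?(ltW E0)//.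
  apply: (@le_lt_trans _ _ (lebesgue_outer (cube 0 M))).
    exact: le_outer_measure.
  by rewrite lebesgue_outer_box ltry.
rewrite fine_gt0// E0/=.
apply: (@le_lt_trans _ _ (lebesgue_outer (cube 0 M))).
  exact: le_outer_measure.
by rewrite lebesgue_outer_box ltry.
Qed.

(** A ball of radius [r] in [E] contains a cube of half-side [r / n.+1%:R]. Two opposite corners of
    it lie in [cube 0 M], which forces [r <= M * n.+1%:R]. *)
Lemma inner_radius_fin E x (e M : R) : (0 < n)%N -> 0 < e ->
  cube x e `<=` E -> E `<=` cube 0 M ->
  exists2 rho : R, 0 < rho & inner_radius E = rho%:E.
Proof.
move=> n0 e0 xE EM.
have eE : (e%:E <= inner_radius E)%E.
  apply: ereal_sup_ubound; exists e => //; split=> //; exists x.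
  exact: subset_trans (@eball_sub_cube _ _) xE.
have E0 : (0 < inner_radius E)%E by apply: lt_le_trans eE; rewrite lte_fin.
have EN : (inner_radius E <= (M * n.+1%:R)%:E)%E.
  apply: ge_ereal_sup => _ [r [r0 [y yE]] <-]; rewrite lee_fin.
  rewrite -ler_pdivrMr ?ltr0n//; set h := r / _.
  have h0 : 0 < h by rewrite divr_gt0.
  have yhM z : cube y h z -> cube 0 M z.
    by move=> /(cube_sub_eball r0)/yE/EM.
  have /yhM/cubeP/(_ (Ordinal n0)) : cube y h (y + const_mx h).
    by apply/cubeP => i; rewrite !mxE addrAC subrr add0r gtr0_norm.
  have /yhM/cubeP/(_ (Ordinal n0)) : cube y h (y - const_mx h).
    by apply/cubeP => i; rewrite !mxE addrAC subrr add0r normrN gtr0_norm.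
  by rewrite !mxE !ler_norml => /andP[? ?] /andP[? ?]; lra.
have EF : inner_radius E \is a fin_num.
  by rewrite ge0_fin_numE ?(ltW E0)//; apply: le_lt_trans EN (ltry _).
exists (fine (inner_radius E)); last by rewrite fineK.
by rewrite fine_gt0// E0/= ltey_eq EF.
Qed.

End volume_perimeter.

(** * Widths and radii compared with balls and cubes *)

Section radii_widths.
Context {R : realType} {n : nat}.
Implicit Types (x y w : 'rV[R]_n) (E : set 'rV[R]_n).

Lemma esphere_dotv w : esphere w -> dotv w w = 1.
Proof.
rewrite /esphere /enorm /= => w1; rewrite -(sqr_sqrtr (a := dotv w w)).
  by rewrite w1 expr1n.
by apply: sumr_ge0 => i _; exact: sqr_ge0.
Qed.

Lemma dotvZl (t : R) x y : dotv (t *: x) y = t * dotv x y.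
Proof. by rewrite mulr_sumr; apply: eq_bigr => i _; rewrite mxE mulrA. Qed.

Lemma enormZ_esphere (t : R) w : esphere w -> enorm (t *: w) = `|t|.
Proof.
move=> w1; rewrite /enorm dotvZl -sqrtr_sqr expr2; congr (Num.sqrt (t * _)).
rewrite -[RHS]mulr1 -(esphere_dotv w1) mulr_sumr.
by apply: eq_bigr => i _; rewrite mxE mulrCA.
Qed.

(** If the ball of radius [r] about [x] lies in [E], the points [x + (r / 2) *: w] and
    [x - (r / 2) *: w] are in [E] and differ by [r] in direction [w]. *)
Lemma inner_radius_le_min_width E : (inner_radius E <= min_width E)%E.
Proof.
apply: ge_ereal_sup => _ [r [r0 [x xE]] <-].
apply: le_ereal_inf_tmp => _ [w w1 <-].
have xw t : `|t| < r -> E (x + t *: w).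
  by move=> tr; apply: xE; rewrite /eball/= addrAC subrr add0r enormZ_esphere.
apply: ereal_sup_ubound; exists (x + (r / 2) *: w).
  by apply: xw; rewrite gtr0_norm; lra.
exists (x + (- (r / 2)) *: w).
  by apply: xw; rewrite normrN gtr0_norm; lra.
rewrite opprD addrACA subrr add0r -scalerBl opprK -splitr dotvZl.
by rewrite esphere_dotv// mulr1.
Qed.

(** Coordinates of a unit vector are at most 1 in modulus, so the scalar product is at most the sum
    of [n] coordinate differences. The factor [n.+1] makes the constant the same as for the outer
    radius. *)
Lemma max_width_le_cube E x (L : R) : 0 <= L -> E `<=` cube x L ->
  (max_width E <= (2 * n.+1%:R * L)%:E)%E.
Proof.
move=> L0 EL; apply: ge_ereal_sup => _ [w w1 <-].
apply: ge_ereal_sup => _ [p Ep [q Eq <-]]; rewrite lee_fin.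
apply: (@le_trans _ _ (\sum_(i < n) 2 * L)).
  apply: ler_sum => i _; apply: le_trans (ler_norm _) _.
  rewrite normrM -[leRHS]mulr1; apply: ler_pM => //.
    have /cubeP/(_ i) := EL _ Ep; have /cubeP/(_ i) := EL _ Eq.
    by rewrite !mxE !ler_norml => /andP[? ?] /andP[? ?]; apply/andP; split; lra.
  by apply: le_trans (ler_norm_enorm _ _) _; rewrite w1.
rewrite sumr_const card_ord -mulrA mulrCA -[leLHS]mulr_natl.
by rewrite ler_wpM2r ?ler_nat// mulr_ge0.
Qed.

Lemma outer_radius_le_cube E x (L : R) : 0 < L -> E `<=` cube x L ->
  (outer_radius E <= (2 * n.+1%:R * L)%:E)%E.
Proof.
move=> L0 EL; apply: (@le_trans _ _ (n.+1%:R * L)%:E).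
  have nL0 : 0 < n.+1%:R * L by rewrite mulr_gt0.
  apply: ereal_inf_lbound; exists (n.+1%:R * L) => //; split=> //; exists x.
  apply: subset_trans EL _; have := @cube_sub_eball _ _ x _ nL0.
  by rewrite mulrAC divff ?mul1r.
by rewrite lee_fin -mulrA ler_peMl ?ler1n// mulr_ge0// ltW.
Qed.

End radii_widths.

(** * Perimeter, width and outer radius bounded through volume and inner radius *)

Lemma convex_body_bounds (R : realType) (n : nat) (s : R) :
  (0 < n)%N -> 0 < s -> s < 1 ->
  exists c1 c2 : R, [/\ 0 < c1, 0 < c2 & forall E : set 'rV[R]_n,
    bounded_set E -> convex_set E -> E° !=set0 ->
    exists v rho : R, [/\ [/\ 0 < v, 0 < rho,
      lebesgue_rV R n E = v%:E & inner_radius E = rho%:E],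
      ((c1 * v / rho `^ s)%:E <= frac_perimeter s E)%E,
      (max_width E <= (c2 * v / rho ^+ n.-1)%:E)%E &
      (outer_radius E <= (c2 * v / rho ^+ n.-1)%:E)%E]].
Proof.
move=> n0 s0 s1; pose m : R := 2 * n.+1%:R.
have m0 : 0 < m by rewrite mulr_gt0.
have N0 : 0 < n%:R :> R by rewrite ltr0n.
(* The constant of [frac_perimeter_ge] at [r = 2 * rho]: there [(2 * rho) ^+ n / 2 ^+ n] is
   [rho ^+ n], and the kernel contributes the remaining power of [rho]. *)
exists (s * (1 - s) / (4 * n%:R) `^ (n%:R + s)).
(* One [m] comes from the passage from a cube to widths and balls, the factor [m ^+ n.-1] from the
   half-side [rho / m] of a cube inside [E]. *)
exists (m * (2 ^+ n.+1 * m ^+ n.-1)); split.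
- apply: mulr_gt0; first by rewrite mulr_gt0 ?subr_gt0.
  by rewrite invr_gt0 powR_gt0// mulr_gt0.
- by apply: mulr_gt0 => //; apply: mulr_gt0; rewrite exprn_gt0.
move=> E bE cE [x0 /interior_cube[e e0 xE]].
have [M M0 EM] := bounded_set_sub_cube bE.
have [v v0 vE] := lebesgue_outer_cubes e0 xE EM.
have [rho rho0 rhoE] := inner_radius_fin n0 e0 xE EM.
have perE : ((s * (1 - s) / (4 * n%:R) `^ (n%:R + s) * v / rho `^ s)%:E <=
    frac_perimeter s E)%E.
  have noE y : ~ cube y (2 * rho) `<=` E.
    move=> yE; suff : ((2 * rho)%:E <= inner_radius E)%E.
      by rewrite rhoE lee_fin; lra.
    apply: ereal_sup_ubound; exists (2 * rho) => //; split; first by lra.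
    by exists y; exact: subset_trans (@eball_sub_cube _ _ _ _) yE.
  have r0 : 0 < 2 * rho by rewrite mulr_gt0.
  have := frac_perimeter_ge n0 r0 s0 s1 cE e0 xE noE.
  rewrite [lebesgue_rV _ _ _]vE -EFinM; apply: le_trans.
  rewrite lee_fin le_eqVlt; apply/orP; left; apply/eqP.
  have -> : n%:R * (2 * (2 * rho)) = (4 * n%:R) * rho by ring.
  have n4 : 0 <= 4 * n%:R :> R by rewrite mulr_ge0.
  rewrite (powRM _ n4 (ltW rho0)) [rho `^ (_ + _)]powRD; last first.
    by rewrite (gt_eqF rho0) implybT.
  rewrite powR_mulrn ?(ltW rho0)// exprMn; field.
  by rewrite !expf_neq0 ?gt_eqF ?powR_gt0// mulr_gt0.
(* Any number below the supremum [rho] is exceeded by the radius of some ball in [E]; [rho / 2] is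
   chosen. *)
have [r rhor [x' x'E]] : exists2 r, rho / 2 < r & exists x, eball x r `<=` E.
  have : ((rho / 2)%:E < inner_radius E)%E by rewrite rhoE lte_fin; lra.
  by move=> /ereal_sup_gt[_ [r [_ [x xrE]] <-]]; exists r => //; exists x.
pose h := rho / 2 / n.+1%:R.
have h0 : 0 < h by rewrite !divr_gt0.
have hE : cube x' h `<=` E.
  apply: subset_trans x'E; apply: subset_trans (@cube_sub_eball _ _ _ _ _) _.
    by rewrite divr_gt0.
  by move=> y /lt_trans; exact.
(* The largest coordinate distance from [x'] that [convex_volume_ge] allows for a point of [E]. *)
pose L := 2 ^+ n.+1 * h * v / h ^+ n.
have L0 : 0 < L by rewrite divr_gt0 ?exprn_gt0// !mulr_gt0 ?exprn_gt0.
have EL : E `<=` cube x' L.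
  move=> p Ep; apply/cubeP => i; rewrite ler_pdivlMr ?exprn_gt0//.
  have := convex_volume_ge i cE h0 hE Ep.
  by rewrite [lebesgue_rV _ _ _]vE -EFinM lee_fin.
have LE : m * (2 ^+ n.+1 * m ^+ n.-1) * v / rho ^+ n.-1 = m * L.
  have h_rho : h = rho / m by rewrite /h /m; field.
  have expn_pred (a : R) : a ^+ n = a * a ^+ n.-1 by rewrite -exprS prednK.
  rewrite /L h_rho expr_div_n (expn_pred rho) (expn_pred m).
  by field; rewrite ?expf_neq0 ?gt_eqF ?mulr_gt0.
exists v, rho; rewrite LE; split=> //.
  exact: max_width_le_cube (ltW L0) EL.
exact: outer_radius_le_cube L0 EL.
Qed.

(** * Elimination of the inner radius *)

Lemma powR_inner_radius (R : realType) (c v rho s : R) :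
  0 < c -> 0 < v -> 0 < rho -> 0 < s ->
  c `^ s^-1 * (v / (c * v / rho `^ s)) `^ s^-1 = rho.
Proof.
move=> c0 v0 r0 s0; have rs0 : 0 < rho `^ s by exact: powR_gt0.
have P0 : 0 < v / (c * v / rho `^ s) by rewrite !divr_gt0// mulr_gt0.
rewrite -powRM ?(ltW c0) ?(ltW P0)//.
have -> : c * (v / (c * v / rho `^ s)) = rho `^ s.
  by field; rewrite !gt_eqF.
by rewrite -powRrM mulfV ?gt_eqF// powRr1// ltW.
Qed.

Lemma powR_volume_ratio (R : realType) (k : nat) (c v rho s : R) :
  0 < c -> 0 < v -> 0 < rho -> 0 < s ->
  v / rho ^+ k = c `^ (- (k%:R / s)) *
    (c * v / rho `^ s) `^ (k%:R / s) * v `^ ((s - k%:R) / s).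
Proof.
move=> c0 v0 r0 s0; have rs0 : 0 < rho `^ s by exact: powR_gt0.
have cv0 : 0 <= c * v by rewrite ltW// mulr_gt0.
have ri0 : 0 <= (rho `^ s)^-1 by rewrite invr_ge0 ltW.
rewrite (powRM _ cv0 ri0) (powRM _ (ltW c0) (ltW v0)).
have -> : (rho `^ s)^-1 `^ (k%:R / s) = (rho ^+ k)^-1.
  rewrite -powRN -powRrM -powR_mulrn ?ltW// -powRN; congr (_ `^ _).
  by field; rewrite gt_eqF.
rewrite powRN; set a := c `^ _; set b := v `^ _; set d := v `^ _.
have a0 : a != 0 by rewrite gt_eqF// powR_gt0.
have bd : b * d = v.
  rewrite -powRD ?(gt_eqF v0) ?implybT//.
  by rewrite -mulrDl addrC subrK divff ?gt_eqF// powRr1// ltW.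
rewrite -{1}bd; field.
by rewrite a0 expf_neq0// gt_eqF.
Qed.

Theorem proposition3p1 (R : realType) (n : nat) (s : R)
    (n_gt0 : (0 < n)%N) (s_gt0 : 0 < s) (s_lt1 : s < 1) :
  exists c C : R, [/\ 0 < c, c < C &
    forall E : set 'rV[R]_n,
      bounded_set E -> convex_set E -> E° !=set0 ->
      let vol : \bar R := lebesgue_rV R n E in
      let Per : \bar R := frac_perimeter s E in
      [/\ (c%:E * (vol / Per) `^ s^-1 <= min_width E)%E,
          (c%:E * (vol / Per) `^ s^-1 <= inner_radius E)%E,
          (max_width E <=
            C%:E * Per `^ ((n%:R - 1) / s) * vol `^ ((1 + s - n%:R) / s))%E,
          (outer_radius E <=
            C%:E * Per `^ ((n%:R - 1) / s) * vol `^ ((1 + s - n%:R) / s))%E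
        & (outer_radius E / inner_radius E <=
            C%:E * Per `^ (n%:R / s) * vol `^ ((s - n%:R) / s))%E]].
Proof.
have [c1 [c2 [c10 c20 bounds]]] := @convex_body_bounds R n s n_gt0 s_gt0 s_lt1.
pose K (k : nat) : R := c2 * c1 `^ (- (k%:R / s)).
have K0 k : 0 < K k by rewrite mulr_gt0// powR_gt0.
have c0 : 0 < c1 `^ s^-1 by exact: powR_gt0.
(* The second constant dominates both [K n.-1] and [K n]; its first summand makes it larger than the
   first constant. *)
exists (c1 `^ s^-1), (c1 `^ s^-1 + (K n.-1 + K n)); split=> //.
  by rewrite ltrDl addr_gt0.
set C := _ + (_ + _).
move=> E bE cE iE vol Per.
have [v [rho [[v0 rho0 volE rhoE] PerE mwE orE]]] := bounds E bE cE iE.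
pose P := c1 * v / rho `^ s.
have P0 : 0 < P by rewrite !divr_gt0 ?mulr_gt0 ?powR_gt0.
have {}PerE : (P%:E <= Per)%E by [].
have Per0 : (0 <= Per)%E by apply: le_trans PerE; rewrite lee_fin ltW.
have volP : (vol / Per <= (v / P)%:E)%E.
  rewrite /vol volE EFinM; apply: lee_wpmul2l; first by rewrite lee_fin ltW.
  have -> : (P^-1)%:E = (P%:E^-1)%E by rewrite inver gt_eqF.
  by rewrite lee_pV2// inE/= lee_fin ltW.
have volPer0 : (0 <= vol / Per)%E.
  by rewrite mule_ge0 ?inve_ge0// /vol volE lee_fin ltW.
have rho_ge : ((c1 `^ s^-1)%:E * (vol / Per) `^ s^-1 <= rho%:E)%E.
  rewrite -[in leRHS](powR_inner_radius c10 v0 rho0 s_gt0) EFinM -poweR_EFin.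
  apply: lee_wpmul2l; first by rewrite lee_fin ltW.
  apply: gt0_ler_poweR volP; rewrite ?invr_ge0 ?(ltW s_gt0)//.
    by rewrite in_itv/= volPer0 leey.
  by rewrite in_itv/= leey lee_fin ltW// divr_gt0.
(* The exponent of [Per] is nonnegative, so its lower bound [P] may be replaced by [Per] itself. *)
have ratio_le k : K k <= C -> (((c2 * v) / rho ^+ k)%:E <=
    C%:E * Per `^ (k%:R / s) * vol `^ ((s - k%:R) / s))%E.
  move=> kC; rewrite -mulrA (powR_volume_ratio k c10 v0 rho0 s_gt0) !mulrA.
  rewrite /vol volE poweR_EFin 2!EFinM.
  apply: lee_wpmul2r; first by rewrite lee_fin powR_ge0.
  apply: lee_pmul; rewrite ?lee_fin ?powR_ge0 ?(ltW (K0 k))//.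
  rewrite -poweR_EFin; apply: gt0_ler_poweR PerE.
  - by rewrite divr_ge0// ltW.
  - by rewrite in_itv/= leey lee_fin ltW.
  - by rewrite in_itv/= Per0 leey.
have predE : n.-1%:R = n%:R - 1 :> R.
  by rewrite -[in RHS](prednK n_gt0) -natr1 addrK.
have exprE : (1 + s - n%:R) / s = (s - n.-1%:R) / s.
  by rewrite predE; congr (_ / _); ring.
have KC : K n.-1 <= C.
  by rewrite /C; have := K0 n; have := K0 n.-1; lra.
rewrite exprE -predE; split.
- by apply: le_trans (inner_radius_le_min_width E); rewrite rhoE.
- by rewrite rhoE.
- exact: le_trans mwE (ratio_le _ KC).
- exact: le_trans orE (ratio_le _ KC).
(* Division by [rho] raises the power of [rho] in the outer radius bound from [n.-1] to [n]. *)
- apply: le_trans (ratio_le n _); last first.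
    by rewrite /C; have := K0 n; have := K0 n.-1; lra.
  rewrite rhoE inver gt_eqF// lee_pdivrMr// -EFinM.
  apply: le_trans orE _; rewrite lee_fin -[in leRHS](prednK n_gt0) exprS/=.
  rewrite le_eqVlt; apply/orP; left; apply/eqP.
  by field; rewrite expf_neq0 gt_eqF.
Qed.
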